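(* Let $\Omega=\{1,2\}$ with counting measure. Let $\mathcal{G}_0=\{g_0\}$ and $\mathcal{G}_1=\operatorname{conv}\{g_1,g_1'\}$ be disjoint convex sets of probability vectors on $\Omega$, with $g_0\notin\mathcal{G}_1$. If $\hat g_1\in\mathcal{G}_1$ maximizes $h\mapsto D_u(g_0,h)$ over $h\in\mathcal{G}_1$ for all $u\in(0,1)$, then $(g_0,\hat g_1)$ minimizes $D_f$ over $\mathcal{G}_0\times\mathcal{G}_1$ for every convex function $f:(0,\infty)\to\mathbb{R}$ with $f(1)=0$.
   Context: For probability vectors $g,h$ on $\Omega=\{1,2\}$: Chernoff functional: for $u\in(0,1)$, $D_u(g,h)=\sum_{i=1}^{2} h_i^{u}\,g_i^{1-u}$. $f$-divergence: for convex $f:(0,\infty)\to\mathbb{R}$ with $f(1)=0$, $D_f(g,h)=\sum_{i=1}^{2} f(h_i/g_i)\,g_i$, with the usual conventions $f(0)=\lim_{x\downarrow0}f(x)$, $0\cdot f(0/0)=0$, and $0\cdot f(c/0)=c\lim_{x\to\infty}f(x)/x$ for $c>0$ (values in $(-\infty,+\infty]$). $\operatorname{conv}$ denotes the convex hull. *)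

(* Defs.v *)
From mathcomp Require Export all_boot all_order all_algebra.
From mathcomp Require Export all_classical all_reals all_analysis.
Export Order.TTheory GRing.Theory Num.Theory.
Export numFieldNormedType.Exports.

Set Implicit Arguments.
Unset Strict Implicit.
Unset Printing Implicit Defensive.

Local Open Scope classical_set_scope.
Local Open Scope ring_scope.

(* Ω = {1,2} is encoded by the indices of 'I_2; integrals against the counting
   measure are the sums over these indices. *)
Definition prob_vector (R : realType) : set 'rV[R]_2 :=
  [set g | (forall i, 0 <= g ord0 i) /\ \sum_(i < 2) g ord0 i = 1].

(* The smallest convex set containing A. *)
Definition convex_hull (R : realType) (V : lmodType R) (A : set V) : set V :=
  smallest (@convex_set R V) A.

(* 0 `^ u = 0 for u != 0, so zero entries are treated as usual for 0 < u < 1. *)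
Definition chernoff (R : realType) (u : R) (g h : 'rV[R]_2) : R :=
  \sum_(i < 2) (h ord0 i) `^ u * (g ord0 i) `^ (1 - u).

(* f : (0, oo) -> R is encoded as a total function on R; only its values on
   (0, oo) enter the definitions below. For f convex on (0, oo) both limits
   exist in ]-oo, +oo]. *)
Definition fdiv_ext (R : realType) (f : R -> R) (x : R) : \bar R :=
  if x == 0 then lim ((f y)%:E @[y --> 0^'+]) else (f x)%:E.

Definition fdiv_slope (R : realType) (f : R -> R) : \bar R :=
  lim ((f x / x)%:E @[x --> +oo]).

(* f(h/g) g, with 0 f(0/0) = 0 and 0 f(c/0) = c lim_{x -> oo} f(x)/x. *)
Definition fdiv_term (R : realType) (f : R -> R) (g h : R) : \bar R :=
  if g == 0 then (if h == 0 then 0%E else (h%:E * fdiv_slope f)%E)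
  else (fdiv_ext f (h / g) * g%:E)%E.

Definition fdiv (R : realType) (f : R -> R) (g h : 'rV[R]_2) : \bar R :=
  (\sum_(i < 2) fdiv_term f (g ord0 i) (h ord0 i))%E.

(* Main.v *)
Require Import Defs.
From mathcomp Require Import ring lra.

Set Implicit Arguments.
Unset Strict Implicit.
Unset Printing Implicit Defensive.

Local Open Scope classical_set_scope.
Local Open Scope ring_scope.

(* On two points the probability vectors form a line. By concavity of the square
   root, moving h towards g0 strictly increases the Chernoff functional with
   u = 1/2, so its maximizer over the segment G1, which misses g0, is the point
   of G1 closest to g0, and ghat lies between g0 and every h in G1. For a
   support slope c of f at 1, f x - c (x - 1) decreases before 1 and increases
   after 1; replacing f by it changes the i-th term of D_f(g, h) by
   - c (h_i - g_i), which sums to 0. Each term of the tilted divergence is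
   monotone in the distance from h_i to g_i. *)

(** * Convex hulls and segments *)

Lemma convex_hull_convex (R : realType) (V : lmodType R) (A : set V) :
  @convex_set R V (convex_hull A).
Proof.
move=> x y t /set_mem xA /set_mem yA; apply/mem_set => B [cB AB].
by apply/set_mem/cB; apply/mem_set; [apply: xA|apply: yA].
Qed.

Lemma convex_hull_segment (R : realType) (V : lmodType R) (A : set V)
    (x y : V) (t : R) : 0 <= t <= 1 ->
  convex_hull A x -> convex_hull A y -> convex_hull A (t *: x + (1 - t) *: y).
Proof.
move=> /andP[t0 t1] xA yA; apply/set_mem.
by apply: (@convex_hull_convex R V A x y (Itv01 t0 t1)); apply/mem_set.
Qed.

(** * Convex functions on the half-line: chords, support slopes, tilts *)

(** Cleared of denominators, the chord inequality survives [x = z] and can be fed to [nra] as a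
    polynomial fact. *)
Lemma convex_three_points (R : realType) (f : R -> R) (x y z : R) :
  convex_function (`]0, +oo[%classic : set R^o) f ->
  0 < x -> x <= y -> y <= z -> (z - x) * f y <= (z - y) * f x + (y - x) * f z.
Proof.
move=> cf x0 xy yz; have [xz|] := ltP x z; last first.
  move=> zx; have -> : z = x by lra.
  have -> : y = x by lra.
  by rewrite !subrr !mul0r addr0.
have zx0 : 0 < z - x by rewrite subr_gt0.
have t0 : 0 <= (z - y) / (z - x) by rewrite divr_ge0 ?subr_ge0 // ltW.
have t1 : (z - y) / (z - x) <= 1 by rewrite ler_pdivrMr // mul1r; lra.
have : f ((z - y) / (z - x) * x + (1 - (z - y) / (z - x)) * z) <=
    (z - y) / (z - x) * f x + (1 - (z - y) / (z - x)) * f z.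
  apply: (cf (Itv01 t0 t1) x z); rewrite inE /= in_itv /= andbT //.
  exact: lt_trans x0 xz.
have -> : (z - y) / (z - x) * x + (1 - (z - y) / (z - x)) * z = y.
  by field; rewrite gt_eqF.
rewrite -(ler_pM2l zx0) => /le_trans; apply; rewrite le_eqVlt; apply/orP; left.
by apply/eqP; field; rewrite gt_eqF.
Qed.

(** Chords reaching [a] from the left are no steeper than chords leaving it to the right; the
    supremum of the left slopes separates the two families. *)
Lemma convex_support (R : realType) (f : R -> R) (a : R) :
  convex_function (`]0, +oo[%classic : set R^o) f -> 0 < a ->
  exists c, forall x, 0 < x -> f a + c * (x - a) <= f x.
Proof.
move=> cf a0; pose S := [set (f a - f x) / (a - x) | x in `]0, a[].
have slope x y : 0 < x < a -> a < y ->
    (f a - f x) / (a - x) <= (f y - f a) / (y - a).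
  move=> /andP[x0 xa] ay.
  have := convex_three_points cf x0 (ltW xa) (ltW ay).
  rewrite ler_pdivlMr ?subr_gt0 // mulrAC ler_pdivrMr ?subr_gt0 //.
  nra.
have a20 : 0 < a / 2 < a by lra.
have S0 : S !=set0.
  by exists ((f a - f (a / 2)) / (a - a / 2)), (a / 2); rewrite //= in_itv.
have Sub y : a < y -> ubound S ((f y - f a) / (y - a)).
  by move=> ay _ [x /= + <-]; rewrite in_itv /= => xa; apply: slope.
exists (sup S) => x x0; have [xa|ax|->] := ltgtP x a; last lra.
- have : (f a - f x) / (a - x) <= sup S.
    apply: ub_le_sup; last by exists x; rewrite //= in_itv /= x0.
    by exists ((f (a + 1) - f a) / (a + 1 - a)); apply: Sub; lra.
  by rewrite ler_pdivrMr ?subr_gt0 //; nra.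
- have : sup S <= (f x - f a) / (x - a) by apply: ge_sup => //; apply: Sub.
  by rewrite ler_pdivlMr ?subr_gt0 //; nra.
Qed.

(** The tilt is convex, nonnegative and zero at 1, so at [y] it lies below the chord from [x] to 1,
    whose largest value is at [x]. *)
Lemma convex_tilt_nonincreasing (R : realType) (f : R -> R) (c x y : R) :
  convex_function (`]0, +oo[%classic : set R^o) f -> f 1 = 0 ->
  (forall z, 0 < z -> c * (z - 1) <= f z) ->
  0 < x -> x <= y -> y <= 1 -> f y - c * (y - 1) <= f x - c * (x - 1).
Proof.
move=> cf f1 cP x0 xy y1; have := convex_three_points cf x0 xy y1.
have := cP _ x0; rewrite f1; have [->//|xny] := eqVneq x y.
have : x < y by rewrite lt_neqAle xny.
nra.
Qed.

Lemma convex_tilt_nondecreasing (R : realType) (f : R -> R) (c x y : R) :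
  convex_function (`]0, +oo[%classic : set R^o) f -> f 1 = 0 ->
  (forall z, 0 < z -> c * (z - 1) <= f z) ->
  1 <= x -> x <= y -> f x - c * (x - 1) <= f y - c * (y - 1).
Proof.
move=> cf f1 cP x1 xy; have := convex_three_points cf ltr01 x1 xy.
have y0 : 0 < y by lra.
have := cP _ y0; rewrite f1; have [->//|xny] := eqVneq x y.
have : x < y by rewrite lt_neqAle xny.
nra.
Qed.

(** For [x > 1] the quotient is the chord slope from 1 times [(x - 1) / x], and both factors are
    nonnegative and nondecreasing. *)
Lemma convex_tilt_slope_nondecreasing (R : realType) (f : R -> R) (c x y : R) :
  convex_function (`]0, +oo[%classic : set R^o) f -> f 1 = 0 ->
  (forall z, 0 < z -> c * (z - 1) <= f z) ->
  1 <= x -> x <= y -> (f x - c * (x - 1)) / x <= (f y - c * (y - 1)) / y.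
Proof.
move=> cf f1 cP x1 xy; have := convex_three_points cf ltr01 x1 xy.
have y0 : 0 < y by lra.
have x0 : 0 < x by lra.
have := cP _ y0; rewrite f1 ler_pdivrMr // mulrAC ler_pdivlMr //.
have [->//|xny] := eqVneq x y; have : x < y by rewrite lt_neqAle xny.
move=> xy' fy; set a := f x - _; set b := f y - _ => H.
have b0 : 0 <= b by rewrite subr_ge0.
have ab : (y - 1) * a <= (x - 1) * b by rewrite /a /b; nra.
have y1 : 0 < y - 1 by lra.
rewrite -(ler_pM2l y1); nra.
Qed.

(** * Existence of the limits in the conventions for zero entries *)

(** The tilt is monotone before 1, so it converges in the extended reals; adding back the affine
    part, whose limit is finite, is harmless. *)
Lemma cvg_convex_at_right0 (R : realType) (f : R -> R) :
  convex_function (`]0, +oo[%classic : set R^o) f -> f 1 = 0 ->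
  cvg ((f y)%:E @[y --> 0^'+]).
Proof.
move=> cf f1; have [c] := convex_support cf ltr01; rewrite f1 => cP.
have {}cP z : 0 < z -> c * (z - 1) <= f z by move=> /cP; rewrite add0r.
have : cvg ((f y - c * (y - 1))%:E @[y --> 0^'+]).
  apply: nonincreasing_at_right_is_cvge; near=> e => x y.
  rewrite !in_itv /= => /andP[x0 xe] /andP[y0 ye] xy; rewrite lee_fin.
  apply: convex_tilt_nonincreasing => //; apply/ltW/(lt_trans ye).
  by near: e; apply: nbhs_right_lt.
have cL : (c * (y - 1))%:E @[y --> 0^'+] --> (c * (0 - 1))%:E.
  apply: cvg_EFin; first by near=> y.
  apply: cvg_at_right_filter; apply: cvgM; first exact: cvg_cst.
  by apply: cvgB; [exact: cvg_id|exact: cvg_cst].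
move=> /cvg_ex[l fl]; apply/cvg_ex; exists (l + (c * (0 - 1))%:E)%E.
have dl : (l +? (c * (0 - 1))%:E)%E by apply: fin_num_adde_defl.
by apply: cvg_trans (cvgeD dl fl cL); apply: near_eq_cvg; near=> y;
  rewrite /= -EFinD subrK.
Unshelve. all: by end_near. Qed.

Lemma cvg_convex_slope (R : realType) (f : R -> R) :
  convex_function (`]0, +oo[%classic : set R^o) f -> f 1 = 0 ->
  cvg ((f x / x)%:E @[x --> +oo]).
Proof.
move=> cf f1; have [c] := convex_support cf ltr01; rewrite f1 => cP.
have {}cP z : 0 < z -> c * (z - 1) <= f z by move=> /cP; rewrite add0r.
pose h x := (f x - c * (x - 1)) / x.
(* Truncating the argument at 1 makes the quotient monotone on the whole line without changing it
   near infinity. *)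
have hl : (h (Order.max 1 x))%:E @[x --> +oo] -->
    ereal_sup (range (fun x => (h (Order.max 1 x))%:E)).
  apply: nondecreasing_cvge => x y xy; rewrite lee_fin.
  apply: convex_tilt_slope_nondecreasing => //; first by rewrite le_max lexx.
  by rewrite ge_max le_max lexx /= le_max xy orbT.
have cL : (c * (1 - x^-1))%:E @[x --> +oo] --> (c * (1 - 0))%:E.
  apply: cvg_EFin; first by near=> x.
  apply: cvgM; first exact: cvg_cst.
  apply: cvgB; first exact: cvg_cst.
  by apply/gtr0_cvgV0; [near=> x|exact: cvg_id].
set l := ereal_sup _ in hl.
apply/cvg_ex; exists (l + (c * (1 - 0))%:E)%E.
have dl : (l +? (c * (1 - 0))%:E)%E by apply: fin_num_adde_defl.
apply: cvg_trans (cvgeD dl hl cL); apply: near_eq_cvg.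
near=> x; rewrite /= -EFinD /h.
have x1 : 1 < x by near: x; apply: nbhs_pinfty_gt; rewrite num_real.
rewrite max_r; last exact: ltW.
by congr EFin; field; rewrite gt_eqF // (lt_trans ltr01).
Unshelve. all: by end_near. Qed.

(** * Monotonicity of the divergence away from [g] *)

Lemma fdiv_ext0_ge (R : realType) (f : R -> R) (c x : R) :
  convex_function (`]0, +oo[%classic : set R^o) f -> f 1 = 0 ->
  (forall z, 0 < z -> c * (z - 1) <= f z) ->
  0 < x -> x <= 1 -> ((f x - c * x)%:E <= fdiv_ext f 0)%E.
Proof.
move=> cf f1 cP x0 x1; apply/lee_subgt0Pr => e e0; rewrite /fdiv_ext eqxx.
apply: lime_ge; first exact: cvg_convex_at_right0.
near=> y; rewrite -EFinB lee_fin.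
have y0 : 0 < y by near: y; apply: nbhs_right_gt.
have yx : y < x by near: y; apply: nbhs_right_lt.
(* This keeps the leftover [- c * y] below [e]; the added 1 covers [c = 0]. *)
have ye : y < e / (`|c| + 1).
  by near: y; apply: nbhs_right_lt; rewrite divr_gt0 // ltr_wpDl.
have := convex_tilt_nonincreasing cf f1 cP y0 (ltW yx) x1.
rewrite ltr_pdivlMr ?ltr_wpDl // in ye.
have : - c <= `|c| by rewrite -normrN ler_norm.
nra.
Unshelve. all: by end_near. Qed.

Lemma fdiv_slope_ge (R : realType) (f : R -> R) (c : R) :
  convex_function (`]0, +oo[%classic : set R^o) f -> f 1 = 0 ->
  (forall z, 0 < z -> c * (z - 1) <= f z) -> (c%:E <= fdiv_slope f)%E.
Proof.
move=> cf f1 cP; apply/lee_subgt0Pr => e e0.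
apply: lime_ge; first exact: cvg_convex_slope.
near=> x; rewrite -EFinB lee_fin.
have x0 : 0 < x by near: x; apply: nbhs_pinfty_gt; rewrite num_real.
(* The support line gives [f x / x >= c - c / x], and here [c / x < e]. *)
have : c / e < x by near: x; apply: nbhs_pinfty_gt; rewrite num_real.
by rewrite ltr_pdivrMr // ler_pdivlMr //; have := cP _ x0; nra.
Unshelve. all: by end_near. Qed.

(** The tilt correction is a finite summand on the right, so possibly infinite terms are never
    subtracted. For [g > 0] the ratios [k / g] and [h / g] lie on one side of 1; for [g = 0] the
    asymptotic slope is at least [c]. *)
Lemma fdiv_term_between (R : realType) (f : R -> R) (c g k h : R) :
  convex_function (`]0, +oo[%classic : set R^o) f -> f 1 = 0 ->
  (forall z, 0 < z -> c * (z - 1) <= f z) ->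
  0 <= g -> 0 <= k -> 0 <= h -> (g <= k <= h) || (h <= k <= g) ->
  (fdiv_term f g k <= fdiv_term f g h + (c * (k - h))%:E)%E.
Proof.
move=> cf f1 cP; rewrite le_eqVlt => /orP[/eqP <-|g0] k0 h0 btw.
  have {btw}kh : k <= h by case/orP: btw => /andP[]; lra.
  rewrite /fdiv_term eqxx; have [hE|hn] := eqVneq h 0.
    have -> : k = 0 by lra.
    by rewrite hE eqxx subrr mulr0 adde0.
  have {}h0 : 0 < h by rewrite lt_neqAle eq_sym hn.
  have cL : (c%:E <= fdiv_slope f)%E by exact: fdiv_slope_ge.
  have -> : (if k == 0%R then 0%E else k%:E * fdiv_slope f)%E
      = (k%:E * fdiv_slope f)%E by case: (eqVneq k 0) => // ->; rewrite mul0e.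
  (* For a finite slope [s] the claim is [0 <= (h - k) * (s - c)]; for an infinite one the right
     side is [+oo] because [h > 0]. *)
  move: cL; case: (fdiv_slope f) => [s| |] //.
  - by rewrite !lee_fin; nra.
  - move=> _; rewrite (gt0_muley (_ : 0 < h%:E)%E) ?lte_fin // addye //.
    exact: leey.
rewrite /fdiv_term (gt_eqF g0) /fdiv_ext !mulf_eq0 invr_eq0 (gt_eqF g0) !orbF.
have btw' : (1 <= k / g <= h / g) || (h / g <= k / g <= 1).
  by rewrite !ler_pM2r ?invr_gt0 // ler_pdivlMr // ler_pdivrMr // mul1r.
have kE : k = k / g * g by rewrite divfK // gt_eqF.
have hE : h = h / g * g by rewrite divfK // gt_eqF.
have cE : c * (k - h) = (c * (k / g - h / g)) * g by rewrite {1}kE {1}hE; ring.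
(* The limit at 0 enters only if [h = 0]: otherwise [k], lying between [h] and [g], is positive
   too. *)
have [{hE}h_eq0|hn] := eqVneq h 0.
  have [->|kn] := eqVneq k 0; first by rewrite h_eq0 subrr mulr0 adde0.
  have {}k0 : 0 < k / g by rewrite divr_gt0 // lt_neqAle eq_sym kn.
  have k1 : k / g <= 1 by move: btw'; rewrite h_eq0 mul0r; lra.
  have := fdiv_ext0_ge cf f1 cP k0 k1; rewrite /fdiv_ext eqxx.
  have -> : (c * (k - h))%:E = ((c * (k / g))%:E * g%:E)%E.
    by rewrite cE h_eq0 mul0r subr0.
  case: (lim _) => [s| |] // H; last first.
    by rewrite gt0_mulye ?lte_fin // addye // leey.
  by move: H; rewrite !lee_fin -mulrDl ler_pM2r // lerBlDr.
have {}h0 : 0 < h by rewrite lt_neqAle eq_sym hn.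
have {}k0 : 0 < k by case/orP: btw => /andP[]; lra.
have {}h0 : 0 < h / g by rewrite divr_gt0.
rewrite (gt_eqF k0).
rewrite lee_fin cE -mulrDl ler_pM2r //.
case/orP: btw' => /andP[a b].
- by have := convex_tilt_nondecreasing cf f1 cP a b; lra.
- by have := convex_tilt_nonincreasing cf f1 cP h0 a b; lra.
Qed.

Lemma fdiv_between (R : realType) (f : R -> R) (g k h : 'rV[R]_2) :
  convex_function (`]0, +oo[%classic : set R^o) f -> f 1 = 0 ->
  prob_vector g -> prob_vector k -> prob_vector h ->
  (forall i, (g ord0 i <= k ord0 i <= h ord0 i)
          || (h ord0 i <= k ord0 i <= g ord0 i)) ->
  (fdiv f g k <= fdiv f g h)%E.
Proof.
move=> cf f1 [g0 _] [k0 k1] [h0 h1] btw.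
have [c] := convex_support cf ltr01; rewrite f1 => cP.
have {}cP z : 0 < z -> c * (z - 1) <= f z by move=> /cP; rewrite add0r.
rewrite /fdiv; apply: (@le_trans _ _ (\sum_(i < 2) (fdiv_term f (g ord0 i)
    (h ord0 i) + (c * (k ord0 i - h ord0 i))%:E))%E).
  by apply: lee_sum => i _; apply: fdiv_term_between.
by rewrite big_split /= sumEFin -mulr_sumr sumrB k1 h1 subrr mulr0 adde0.
Qed.

(** * The Chernoff functional at [u = 1/2] *)

Lemma chernoff_half (R : realType) (g h : 'rV[R]_2) :
  (forall i, 0 <= g ord0 i) -> (forall i, 0 <= h ord0 i) ->
  chernoff 2^-1 g h = \sum_(i < 2) Num.sqrt (h ord0 i) * Num.sqrt (g ord0 i).
Proof.
move=> g0 h0; apply: eq_bigr => i _.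
by rewrite [1 - _](_ : _ = 2^-1) ?powR12_sqrt //; lra.
Qed.

(** Twice the gap to 1 is the sum of the squared differences of square roots (Hellinger distance),
    which vanishes only for [g = h]. *)
Lemma chernoff_half_lt1 (R : realType) (g h : 'rV[R]_2) :
  prob_vector g -> prob_vector h -> g <> h -> chernoff 2^-1 g h < 1.
Proof.
move=> [g0 g1] [h0 h1] gh; rewrite chernoff_half //.
pose d i := Num.sqrt (h ord0 i) - Num.sqrt (g ord0 i).
have dE : \sum_(i < 2) d i ^+ 2
    = \sum_(i < 2) h ord0 i + \sum_(i < 2) g ord0 i
      - (\sum_(i < 2) Num.sqrt (h ord0 i) * Num.sqrt (g ord0 i)) * 2.
  rewrite mulr_suml -big_split -sumrB /=; apply: eq_bigr => i _.
  by rewrite /d sqrrB !sqr_sqrtr //; ring.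
suff : 0 < \sum_(i < 2) d i ^+ 2 by rewrite dE h1 g1; lra.
rewrite lt_neqAle sumr_ge0 ?andbT; last by move=> i _; exact: sqr_ge0.
apply/eqP => /esym/eqP; rewrite psumr_eq0 => [/allP d0|i _]; last exact: sqr_ge0.
apply: gh; apply/rowP => i; rewrite -[0]/ord0.
have := d0 i (mem_index_enum _); rewrite sqrf_eq0 subr_eq0 => /eqP hg.
by rewrite -(sqr_sqrtr (g0 i)) -(sqr_sqrtr (h0 i)) hg.
Qed.

(* Concavity of the square root gives D(g, t g + (1 - t) h) >= t + (1 - t) D(g, h). *)
Lemma chernoff_half_segment (R : realType) (g h : 'rV[R]_2) (t : R) :
  prob_vector g -> prob_vector h -> g <> h -> 0 < t <= 1 ->
  chernoff 2^-1 g h < chernoff 2^-1 g (t *: g + (1 - t) *: h).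
Proof.
move=> pg ph gh /andP[t0 t1]; have := chernoff_half_lt1 pg ph gh.
case: pg ph => [g0 g1] [h0 h1].
have m0 i : 0 <= (t *: g + (1 - t) *: h) ord0 i.
  by rewrite !mxE addr_ge0 // mulr_ge0 // ?subr_ge0 // ltW.
set D := chernoff _ g h => D1.
(* Strictness comes from [D < 1] and [t > 0]; writing 1 as the sum of the entries of [g] leaves an
   entrywise comparison. *)
apply: (@lt_le_trans _ _ (t * \sum_(i < 2) g ord0 i + (1 - t) * D)).
  by rewrite g1; nra.
rewrite /D !chernoff_half // !mulr_sumr -big_split /=; apply: ler_sum => i _.
set s := Num.sqrt (g _ _); set r := Num.sqrt (h _ _).
have s0 : 0 <= s by apply: sqrtr_ge0.
have r0 : 0 <= r by apply: sqrtr_ge0.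
have gE : g ord0 i = s ^+ 2 by rewrite sqr_sqrtr.
have hE : h ord0 i = r ^+ 2 by rewrite sqr_sqrtr.
have sr : t * s + (1 - t) * r <= Num.sqrt ((t *: g + (1 - t) *: h) ord0 i).
  have a0 : 0 <= t * s + (1 - t) * r.
    by rewrite addr_ge0 // mulr_ge0 // ?subr_ge0 // ltW.
  rewrite -(ger0_norm a0) -sqrtr_sqr ler_wsqrtr // !mxE gE hE -subr_ge0.
  (* This is the variance of the values [s], [r] under the weights [t], [1 - t]. *)
  have -> : t * s ^+ 2 + (1 - t) * r ^+ 2 - (t * s + (1 - t) * r) ^+ 2
      = t * (1 - t) * (s - r) ^+ 2 by ring.
  by rewrite mulr_ge0 ?sqr_ge0 // mulr_ge0 ?subr_ge0 // ltW.
apply: le_trans (ler_wpM2r s0 sr); rewrite gE le_eqVlt; apply/orP; left.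
by apply/eqP; ring.
Qed.

(** * The line of two-point probability vectors, and the conclusion *)

Lemma prob_vector_sum (R : realType) (g : 'rV[R]_2) :
  prob_vector g -> g ord0 ord0 + g ord0 ord_max = 1.
Proof.
move=> [_]; rewrite big_ord_recl big_ord1 (_ : lift _ _ = ord_max) //.
exact/val_inj.
Qed.

(** The first entry determines the second, so a weight found for the first entry works for the whole
    vector. *)
Lemma prob_vector_segment (R : realType) (g k h : 'rV[R]_2) :
  prob_vector g -> prob_vector k -> prob_vector h ->
  (g ord0 ord0 <= k ord0 ord0 <= h ord0 ord0)
    || (h ord0 ord0 <= k ord0 ord0 <= g ord0 ord0) ->
  exists2 t, 0 <= t <= 1 & k = t *: g + (1 - t) *: h.
Proof.
move=> /prob_vector_sum g1 /prob_vector_sum k1 /prob_vector_sum h1 btw.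
suff [t t01 kE] : exists2 t, 0 <= t <= 1 &
    k ord0 ord0 = t * g ord0 ord0 + (1 - t) * h ord0 ord0.
  exists t => //; apply/rowP => i; rewrite !mxE.
  have [->|->] : i = ord0 \/ i = ord_max.
    by case: i => [[|[|//]] ?]; [left|right]; apply/val_inj.
  - exact: kE.
  - have -> : k 0 ord_max = 1 - k ord0 ord0 by rewrite -k1 addrC addKr.
    have -> : g 0 ord_max = 1 - g ord0 ord0 by rewrite -g1 addrC addKr.
    have -> : h 0 ord_max = 1 - h ord0 ord0 by rewrite -h1 addrC addKr.
    by rewrite kE; ring.
have [gh|gh|gh] := ltgtP (g ord0 ord0) (h ord0 ord0).
- exists ((h ord0 ord0 - k ord0 ord0) / (h ord0 ord0 - g ord0 ord0)).
    rewrite divr_ge0 /= ?ler_pdivrMr; lra.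
  by field; lra.
- exists ((h ord0 ord0 - k ord0 ord0) / (h ord0 ord0 - g ord0 ord0)).
    rewrite -opprB -[X in _ / X]opprB invrN mulrNN divr_ge0 /= ?ler_pdivrMr; lra.
  by field; lra.
- by exists 1; lra.
Qed.

Theorem theoremV1 (R : realType) (g0 g1 g1' ghat : 'rV[R]_2)
    (G0 G1 : set 'rV[R]_2) :
  G0 = [set g0] ->
  G1 = convex_hull [set g1; g1'] ->
  G0 `<=` @prob_vector R ->
  G1 `<=` @prob_vector R ->
  G0 `&` G1 = set0 ->
  ~ G1 g0 ->
  G1 ghat ->
  (forall u : R, 0 < u < 1 ->
     forall h, G1 h -> chernoff u g0 h <= chernoff u g0 ghat) ->
  forall f : R -> R,
    convex_function (`]0, +oo[%classic : set R^o) f -> f 1 = 0 ->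
    (G0 `*` G1) (g0, ghat) /\
    (forall g h, (G0 `*` G1) (g, h) -> (fdiv f g0 ghat <= fdiv f g h)%E).
Proof.
move=> G0E G1E P0 P1 _ g0N ghat1 hmax f cf f1; split; first by rewrite G0E.
move=> g h; rewrite G0E => -[/= -> h1].
have pg : prob_vector g0 by apply: P0; rewrite G0E.
have pk := P1 _ ghat1; have ph := P1 _ h1.
have mid t : 0 <= t <= 1 -> g0 <> t *: h + (1 - t) *: ghat.
  by move=> t01 g0E; apply: g0N; rewrite g0E G1E; apply: convex_hull_segment;
    rewrite -?G1E.
(* One of the three points lies between the others. It is not [g0], which convexity would then put
   in [G1]. *)
have [/(prob_vector_segment ph pg pk)[t t01 /mid]//|] :=
  boolP ((h ord0 ord0 <= g0 ord0 ord0 <= ghat ord0 ord0)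
      || (ghat ord0 ord0 <= g0 ord0 ord0 <= h ord0 ord0)).
move=> gN; have [|kN] :=
  boolP ((g0 ord0 ord0 <= h ord0 ord0 <= ghat ord0 ord0)
      || (ghat ord0 ord0 <= h ord0 ord0 <= g0 ord0 ord0)).
  (* With [h] in the middle, either [t = 0] and [h = ghat], or [h] beats [ghat] at [u = 1/2],
     against [hmax]. *)
  move=> /(prob_vector_segment pg ph pk)[t /andP[t0 t1] hE].
  have [tE|tn] := eqVneq t 0.
    by rewrite hE tE scale0r add0r subr0 scale1r.
  have t01 : 0 < t <= 1 by rewrite lt_neqAle eq_sym tn t0.
  have gk : g0 <> ghat by move=> gk; apply: g0N; rewrite gk.
  have := chernoff_half_segment pg pk gk t01; rewrite -hE.
  by rewrite ltNge hmax //; lra.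
(* Only [ghat] can now be in the middle; the second entries have the reverse order, as each pair
   sums to 1. *)
apply: fdiv_between => // i.
have := prob_vector_sum pg; have := prob_vector_sum pk; have := prob_vector_sum ph.
have [->|->] : i = ord0 \/ i = ord_max.
  by case: i => [[|[|//]] ?]; [left|right]; apply/val_inj.
all: lra.
Qed.
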